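(* For each integer $n\ge 0$ let $Y_n(q)$ be the $q$-series defined by $$\sum_{n\ge 0} Y_n(q)\,\frac{X^n}{n!}=\exp\left(\frac{\theta(q)^2X}{2}\right)\cdot \Omega\left(\frac X2\right),\qquad \Omega(X)=\sum_{n\ge 0}U_{2n}(q)\,\frac{X^{2n}}{(2n+1)!}.$$ Then for each non-negative integer $n$ the following are true. (1) $Y_n(q)=\frac{1}{n+1}+O(q)$ is a weight $n$ quasimodular form on $\Gamma_0(4)$. (2) $$Y_n(q)=\frac{1}{2^n(n+1)}\sum_{k=0}^{\lfloor n/2\rfloor}\binom{n+1}{2k+1}\,\theta(q)^{2n-4k}\,U_{2k}(q).$$
   Context: Here $\theta(q)=\prod_{k\ge1}(1-q^{2k})(1+q^{2k-1})^2=1+2q+2q^4+2q^9+\cdots$ is the weight $1/2$ theta function. Ramanujan's series are $$U_{2n}(q)=\frac{\sum_{k\ge0}(-1)^k(2k+1)^{2n+1}q^{k(k+1)/2}}{\sum_{k\ge0}(-1)^k(2k+1)q^{k(k+1)/2}}\qquad(n\ge 0).$$ The normalized Eisenstein series are $E_2=1-24\sum_{n\ge1}\sum_{d\mid n}d\,q^n$, $E_4=1+240\sum_{n\ge1}\sum_{d\mid n}d^3q^n$, $E_6=1-504\sum_{n\ge1}\sum_{d\mid n}d^5q^n$. Convention: the quasimodular forms on $\Gamma_0(4)$ under consideration are the elements of the ring $\mathbb C[\theta,E_2,E_4,E_6]$, graded by giving $\theta,E_2,E_4,E_6$ the weights $1/2,2,4,6$; a quasimodular form of weight $n$ is an element that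 is homogeneous of weight $n$. (In particular, in odd weight a character, as for $\theta^2$, is allowed.) It is known that each $U_{2n}(q)$ is a quasimodular form of weight $2n$ on $\mathrm{SL}_2(\mathbb Z)$, i.e. a homogeneous element of weight $2n$ of $\mathbb C[E_2,E_4,E_6]$. *)

(* Defs.v *)
From HB Require Import structures.
From mathcomp Require Import all_boot all_order all_algebra.
From mathcomp Require Import reals complex mpoly.
From mathcomp Require boolp.

Set Implicit Arguments.
Unset Strict Implicit.
Unset Printing Implicit Defensive.

Import GRing.Theory.

Local Open Scope ring_scope.

Record fps (R : Type) := Fps { fcoef : nat -> R }.

Lemma fpsP (R : Type) (f g : fps R) : fcoef f =1 fcoef g -> f = g.
Proof. by case: f g => [f] [g] /= /boolp.funext ->. Qed.

HB.instance Definition _ (R : Type) := boolp.gen_eqMixin (fps R).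
HB.instance Definition _ (R : Type) := boolp.gen_choiceMixin (fps R).

Section Ring.
Variable R : comNzRingType.
Implicit Types f g h : fps R.

Definition fps_const (c : R) : fps R := Fps (fun n => if n == 0%N then c else 0).
Definition fps_add f g : fps R := Fps (fun n => fcoef f n + fcoef g n).
Definition fps_opp f : fps R := Fps (fun n => - fcoef f n).
Definition fps_mul f g : fps R :=
  Fps (fun n => \sum_(i < n.+1) fcoef f i * fcoef g (n - i)%N).
Definition fps_scale (c : R) f : fps R := Fps (fun n => c * fcoef f n).

Fact fps_addA : associative fps_add.
Proof. by move=> f g h; apply: fpsP => n /=; rewrite addrA. Qed.
Fact fps_addC : commutative fps_add.
Proof. by move=> f g; apply: fpsP => n /=; rewrite addrC. Qed.
Fact fps_add0 : left_id (fps_const 0) fps_add.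
Proof. by move=> f; apply: fpsP => n /=; rewrite if_same add0r. Qed.
Fact fps_addN : left_inverse (fps_const 0) fps_opp fps_add.
Proof. by move=> f; apply: fpsP => n /=; rewrite if_same addNr. Qed.

HB.instance Definition _ :=
  GRing.isZmodule.Build (fps R) fps_addA fps_addC fps_add0 fps_addN.

Fact fps_mulA : associative fps_mul.
Proof.
pose T f n := \poly_(i < n.+1) fcoef f i.
have coefT f g n : fcoef (fps_mul f g) n = (T f n * T g n)`_n.
  rewrite coefM; apply: eq_bigr => i _.
  by rewrite !coef_poly ltn_ord ltnS leq_subr.
have trunc f g n i : (i <= n)%N ->
    (T (fps_mul f g) n)`_i = (T f n * T g n)`_i.
  move=> le_in; rewrite coef_poly ltnS le_in coefM; apply: eq_bigr => j _.
  rewrite !coef_poly (leq_trans (ltn_ord j)) ?ltnS //.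
  by rewrite (leq_trans (leq_subr _ _)).
move=> f g h; apply: fpsP => n; rewrite !coefT.
transitivity ((T f n * (T g n * T h n))`_n).
  by rewrite !coefM; apply: eq_bigr => i _; rewrite trunc ?leq_subr.
rewrite mulrA !coefM; apply: eq_bigr => i _.
by rewrite trunc // -ltnS.
Qed.
Fact fps_mulC : commutative fps_mul.
Proof.
move=> f g; apply: fpsP => n /=.
rewrite (reindex_inj rev_ord_inj) /=; apply: eq_bigr => i _.
by rewrite mulrC subSS subKn // -ltnS.
Qed.
Fact fps_mul1 : left_id (fps_const 1) fps_mul.
Proof.
move=> f; apply: fpsP => n /=; rewrite big_ord_recl /= mul1r subn0.
by rewrite big1 ?addr0 // => i _; rewrite mul0r.
Qed.
Fact fps_mulDl : left_distributive fps_mul fps_add.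
Proof.
move=> f g h; apply: fpsP => n /=.
by rewrite -big_split; apply: eq_bigr => i _; rewrite mulrDl.
Qed.
Fact fps_one_neq0 : fps_const 1 != 0.
Proof.
apply/eqP => /(congr1 (fun f => fcoef f 0)) /= /eqP.
by rewrite oner_eq0.
Qed.

HB.instance Definition _ := GRing.Zmodule_isComNzRing.Build (fps R)
  fps_mulA fps_mulC fps_mul1 fps_mulDl fps_one_neq0.

Fact fps_scaleA a b f : fps_scale a (fps_scale b f) = fps_scale (a * b) f.
Proof. by apply: fpsP => n /=; rewrite mulrA. Qed.
Fact fps_scale1 : left_id 1 fps_scale.
Proof. by move=> f; apply: fpsP => n /=; rewrite mul1r. Qed.
Fact fps_scaleDr : right_distributive fps_scale +%R.
Proof. by move=> a f g; apply: fpsP => n /=; rewrite mulrDr. Qed.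
Fact fps_scaleDl f : {morph fps_scale^~ f : a b / a + b}.
Proof. by move=> a b; apply: fpsP => n /=; rewrite mulrDl. Qed.

HB.instance Definition _ := GRing.Zmodule_isLmodule.Build R (fps R)
  fps_scaleA fps_scale1 fps_scaleDr fps_scaleDl.

Fact fps_scaleAl a f g : a *: (f * g) = (a *: f) * g.
Proof.
apply: fpsP => n /=; rewrite mulr_sumr.
by apply: eq_bigr => i _; rewrite mulrA.
Qed.

HB.instance Definition _ := GRing.Lmodule_isLalgebra.Build R (fps R) fps_scaleAl.
HB.instance Definition _ := GRing.Lalgebra_isComAlgebra.Build R (fps R).

Definition fpsX : fps R := Fps (fun n => (n == 1%N)%:R).

(* f = g + O(q^N) *)
Definition eq_mod_deg (N : nat) f g :=
  forall n, (n < N)%N -> fcoef f n = fcoef g n.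

(* Limits of partial sums and products for the adic topology: if F k = O(q^k),
   resp. F k = 1 + O(q^k), for all k, then the n-th coefficient is the same in
   all partial sums (products) over k < N with n < N; see fps_sumE, fps_prodE.
   All uses below satisfy this condition. *)
Definition fps_sum (F : nat -> fps R) : fps R :=
  Fps (fun n => fcoef (\sum_(k < n.+1) F k) n).
Definition fps_prod (F : nat -> fps R) : fps R :=
  Fps (fun n => fcoef (\prod_(k < n.+1) F k) n).

Lemma fps_sumE (F : nat -> fps R) (N : nat) :
  (forall k, eq_mod_deg k (F k) 0) ->
  eq_mod_deg N (fps_sum F) (\sum_(k < N) F k).
Proof.
move=> F0 n /subnK <-; rewrite /=; elim: (N - n.+1)%N => [//|m ->].
rewrite addSn big_ord_recr /= -[LHS]addr0; congr (_ + _).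
by rewrite F0 //= ?if_same // leq_addl.
Qed.

Lemma fps_prodE (F : nat -> fps R) (N : nat) :
  (forall k, eq_mod_deg k (F k) 1) ->
  eq_mod_deg N (fps_prod F) (\prod_(k < N) F k).
Proof.
move=> F1 n /subnK <-; rewrite /=; elim: (N - n.+1)%N => [//|m ->].
rewrite addSn big_ord_recr /= -[in LHS](mulr1 (\prod_(_ < _) _)).
apply: eq_bigr => i _; rewrite F1 //.
by rewrite (leq_ltn_trans (leq_subr _ _)) // leq_addl.
Qed.

Lemma fps_expr_deg f : fcoef f 0 = 0 -> forall k, eq_mod_deg k (f ^+ k) 0.
Proof.
move=> f0; elim=> [//|k IHk] n; rewrite ltnS => le_nk.
rewrite exprS /= if_same big_ord_recl f0 mul0r add0r big1 // => i _.
case: n le_nk i => [_ []//|n] le_nk i.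
rewrite lift0 subSS IHk /= ?if_same ?mulr0 //.
exact: leq_ltn_trans (leq_subr _ _) le_nk.
Qed.

(* f(g(q)), for g with constant term 0 *)
Definition fps_comp f g : fps R := fps_sum (fun k => fcoef f k *: g ^+ k).

End Ring.

Arguments fpsX {R}.

Section UnitRing.
Variable R : comUnitRingType.
Implicit Types f g : fps R.

Definition fps_unit : {pred fps R} := fun f => fcoef f 0 \is a GRing.unit.

(* geometric series: f = c (1 - u) with u = O(q) *)
Definition fps_inv f : fps R :=
  if f \in fps_unit then
    let c := fcoef f 0 in
    c^-1 *: fps_sum (fun k => (1 - c^-1 *: f) ^+ k)
  else f.

Fact fps_mulVf : {in fps_unit, left_inverse 1 fps_inv *%R}.
Proof.
move=> f uf; rewrite /fps_inv uf /=; set c := fcoef f 0.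
set u := 1 - _.
have u0 : fcoef u 0 = 0 by rewrite /= mulVr ?subrr.
have fE : f = c *: (1 - u) by rewrite /u opprB addrC subrK scalerA divrr ?scale1r.
rewrite [X in _ * X]fE -scalerAl -scalerAr scalerA mulVr // scale1r mulrC.
apply: fpsP => n.
transitivity (fcoef ((1 - u) * \sum_(k < n.+1) u ^+ k) n).
  apply: eq_bigr => i _; congr (_ * _).
  apply: (@fps_sumE _ _ n.+1); last by rewrite ltnS leq_subr.
  exact: fps_expr_deg.
rewrite -opprB mulNr -subrX1 opprB.
transitivity (fcoef (1 : fps R) n - fcoef (u ^+ n.+1) n) => //.
by rewrite (fps_expr_deg u0) //= if_same subr0.
Qed.
Fact fps_unitPl f g : g * f = 1 -> fps_unit f.
Proof.
move=> /(congr1 (fun h => fcoef h 0)) /=; rewrite big_ord1 /= => gf.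
by apply/unitrPr; exists (fcoef g 0); rewrite mulrC.
Qed.
Fact fps_inv_out : {in [predC fps_unit], fps_inv =1 id}.
Proof. by move=> f /negbTE; rewrite /fps_inv => ->. Qed.

HB.instance Definition _ := GRing.ComNzRing_hasMulInverse.Build (fps R)
  fps_mulVf fps_unitPl fps_inv_out.

(* exp(f), for f with constant term 0 *)
Definition fps_exp f : fps R := fps_comp (Fps (fun k => k`!%:R^-1)) f.

End UnitRing.

Section QSeries.
Variable R : realType.
Local Notation C := R[i].
Local Notation q := (@fpsX C).

Definition theta : fps C :=
  fps_prod (fun k => (1 - q ^+ (2 * k.+1)) * (1 + q ^+ (2 * k).+1) ^+ 2).

Definition ramanujan_num (m : nat) : fps C :=
  fps_sum (fun k =>
    ((-1) ^+ k * (2 * k + 1)%:R ^+ m) *: q ^+ (k * k.+1)./2).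

(* U n is the series written U_{2n} *)
Definition U (n : nat) : fps C :=
  ramanujan_num (2 * n + 1) / ramanujan_num 1.

Definition sigma (k n : nat) : nat := \sum_(d <- divisors n) d ^ k.

Definition sigma_series (k : nat) : fps C :=
  fps_sum (fun n => if n == 0%N then 0 else (sigma k n)%:R *: q ^+ n).

Definition E2 : fps C := 1 - 24%:R *: sigma_series 1.
Definition E4 : fps C := 1 + 240%:R *: sigma_series 3.
Definition E6 : fps C := 1 - 504%:R *: sigma_series 5.

(* Four variables, standing for theta, E2, E4, E6. Weights are doubled, so
   that the weight 1/2 of theta becomes the integer 1. *)
Definition qm_gen : 'I_4 -> fps C := tnth [tuple theta; E2; E4; E6].
Definition qm_weight2 : 'I_4 -> nat := tnth [tuple 1; 4; 8; 12]%N.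

Definition mnm_weight2 (m : 'X_{1..4}) : nat := (\sum_(i < 4) m i * qm_weight2 i)%N.

Fact mnm_weight2_0 : mnm_weight2 0%MM = 0%N.
Proof. by rewrite /mnm_weight2 big1 // => i _; rewrite mnm0E. Qed.
Fact mnm_weight2_D :
  {morph mnm_weight2 : m1 m2 / (m1 + m2)%MM >-> (m1 + m2)%N}.
Proof.
move=> m1 m2; rewrite /mnm_weight2 -big_split /=.
by apply: eq_bigr => i _; rewrite mnmDE mulnDl.
Qed.
HB.instance Definition _ :=
  isMeasure.Build 4 mnm_weight2 mnm_weight2_0 mnm_weight2_D.

Definition quasimodular (n : nat) (f : fps C) : Prop :=
  exists2 P : {mpoly C[4]},
    P \is (2 * n).-homog for mnm_weight2 & f = mmap (in_alg (fps C)) qm_gen P.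

Definition Omega : fps (fps C) :=
  fps_sum (fun n => ((2 * n + 1)`!%:R^-1 * U n) *: fpsX ^+ (2 * n)).

Definition egf (Y : nat -> fps C) : fps (fps C) :=
  fps_sum (fun n => (n`!%:R^-1 * Y n) *: fpsX ^+ n).

End QSeries.

(* Main.v *)
Require Import Defs.
From mathcomp Require Import all_boot all_order all_algebra.
From mathcomp Require Import reals complex mpoly.
From mathcomp Require Import ring zify.
Import GRing.Theory.
Local Open Scope ring_scope.

Set Implicit Arguments.
Unset Strict Implicit.
Unset Printing Implicit Defensive.

(** Comparing coefficients of [X^n] on both sides of the generating function
    gives the closed formula for [Y n] by a rearrangement of factorials
    ([egf_mul_coef]). Its constant term follows, because [theta] and all the [U n]
    have constant term [1] and the binomials [C(n+1, 2k+1)] add up to [2^n]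
    ([sum_bin_odd]). It is quasimodular of weight [n] because [U n] is quasimodular
    of weight [2n], and this is the substance of the proof.

    Write [D = q d/dq] and [A m] for the series [sum (-1)^k (2k+1)^m q^(k(k+1)/2)].
    Since [(2k+1)^2 = 8 k(k+1)/2 + 1], one has [A (m+2) = 8 D (A m) + A m]. Jacobi's
    identity [A 1 = prod (1 - q^j)^3] gives [D (A 1) / A 1 = -3 sum sigma_1(n) q^n].
    As [U n = A (2n+1) / A 1], this yields the recursion
    [U (n+1) = 8 D (U n) + E2 * U n] ([U_recursion]). So it is enough that [D] maps
    weight [k] to weight [k+2] in [C[E2, E4, E6]], that is, to have Ramanujan's
    equations for [D E2], [D E4] and [D E6].

    Jacobi's identity is proved in finite form: the derivative at [z = 1] of the
    finite triple product, whose coefficients are [q]-binomials, is up to sign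
    [prod_(j<=n) (1 - q^j)^2] ([sum_gauss_term]); multiplying by another
    [prod_(j<=n) (1 - q^j)] makes every [q]-binomial tend to [1] ([jacobi_identity]).

    Ramanujan's equations amount to evaluations of the convolutions of the
    divisor sums [sigma_1 * sigma_1], [sigma_1 * sigma_3], [sigma_1 * sigma_5] and
    [sigma_3 * sigma_3]. All four come from one identity of Liouville's type,
    [liouville_identity], for sums over the solutions of [a x + b y = n] in positive
    integers, which follows from the bijection
    [(a, b, x, y) |-> (a - b, b, x, x + y)]. Three of them use the kernels
    [(a+b)^(2m) + a^(2m) + b^(2m)] with [m = 1, 2, 3]; in weight [8], where two
    convolutions are unknown, [weierstrass_kernel] supplies the second relation. *)

(** * Coefficients, congruences and the derivation q d/dq *)

Section Derivation.
Variable K : comNzRingType.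
Implicit Types f g : fps K.

Lemma fcoefM f g n :
  fcoef (f * g) n = \sum_(i < n.+1) fcoef f i * fcoef g (n - i)%N.
Proof. by []. Qed.

Lemma fcoefM0 f g : fcoef (f * g) 0 = fcoef f 0 * fcoef g 0.
Proof. by rewrite fcoefM big_ord1. Qed.

Lemma fcoefD f g n : fcoef (f + g) n = fcoef f n + fcoef g n.
Proof. by []. Qed.

Lemma fcoefB f g n : fcoef (f - g) n = fcoef f n - fcoef g n.
Proof. by []. Qed.

Lemma fcoef1 n : fcoef (1 : fps K) n = (n == 0%N)%:R.
Proof. by rewrite /=; case: eqP. Qed.

Lemma fcoef0 n : fcoef (0 : fps K) n = 0.
Proof. by rewrite /= if_same. Qed.

Lemma fcoef_sum I (r : seq I) (P : pred I) (F : I -> fps K) n :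
  fcoef (\sum_(i <- r | P i) F i) n = \sum_(i <- r | P i) fcoef (F i) n.
Proof. by elim/big_rec2: _ => [|i x y _ <-//]; rewrite fcoef0. Qed.

Lemma fcoef_natmul f m n : fcoef (m%:R * f) n = m%:R * fcoef f n.
Proof. by rewrite mulr_natl -scaler_nat. Qed.

Lemma fcoef_mulX f n :
  fcoef (fpsX * f) n = if n is m.+1 then fcoef f m else 0.
Proof.
rewrite fcoefM big_ord_recl mul0r add0r; case: n => [|n]; first by rewrite big_ord0.
by rewrite big_ord_recl subSS mul1r subn0 big1 ?addr0 // => i _; rewrite mul0r.
Qed.

Lemma fcoef_mulXn f k n :
  fcoef (fpsX ^+ k * f) n = if (k <= n)%N then fcoef f (n - k) else 0.
Proof.
elim: k n => [|k IHk] n; first by rewrite expr0 mul1r subn0.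
by rewrite exprS -mulrA fcoef_mulX; case: n => [//|n]; rewrite IHk.
Qed.

Lemma fcoefXn k n : fcoef (fpsX ^+ k : fps K) n = (n == k)%:R.
Proof.
rewrite -[fpsX ^+ k]mulr1 fcoef_mulXn fcoef1 subn_eq0 eqn_leq andbC.
by case: (k <= n)%N.
Qed.

(** The derivation [q d/dq]. *)
Definition fps_deriv f : fps K := Fps (fun n => n%:R * fcoef f n).

Lemma fcoef_deriv f n : fcoef (fps_deriv f) n = n%:R * fcoef f n.
Proof. by []. Qed.

Lemma fps_derivD f g : fps_deriv (f + g) = fps_deriv f + fps_deriv g.
Proof. by apply: fpsP => n /=; rewrite mulrDr. Qed.

Lemma fps_derivZ c f : fps_deriv (c *: f) = c *: fps_deriv f.
Proof. by apply: fpsP => n /=; rewrite mulrCA. Qed.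

Lemma fps_derivN f : fps_deriv (- f) = - fps_deriv f.
Proof. by rewrite -scaleN1r fps_derivZ scaleN1r. Qed.

Lemma fps_derivMn m f : fps_deriv (m%:R * f) = m%:R * fps_deriv f.
Proof. by rewrite !mulr_natl -!scaler_nat fps_derivZ. Qed.

Lemma fps_deriv1 : fps_deriv 1 = 0.
Proof. by apply: fpsP => -[|n]; rewrite fcoef0 /= ?mul0r ?mulr0. Qed.

Lemma fps_derivM f g : fps_deriv (f * g) = fps_deriv f * g + f * fps_deriv g.
Proof.
apply: fpsP => n; rewrite /= mulr_sumr -big_split /=.
apply: eq_bigr => i _; rewrite -{1}(subnKC (leq_ord i)) natrD.
ring.
Qed.

Lemma fps_derivXn n : fps_deriv (fpsX ^+ n) = n%:R * fpsX ^+ n.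
Proof.
apply: fpsP => i; rewrite fcoef_natmul /= fcoefXn.
by case: eqP => [->//|]; rewrite !mulr0.
Qed.

Lemma eq_mod_degM N f f' g g' :
  eq_mod_deg N f f' -> eq_mod_deg N g g' -> eq_mod_deg N (f * g) (f' * g').
Proof.
move=> ff gg n ltnN; rewrite !fcoefM; apply: eq_bigr => i _.
have le_in : (i <= n)%N by rewrite -ltnS.
by rewrite ff ?gg ?(leq_ltn_trans _ ltnN) ?leq_subr.
Qed.

Lemma eq_mod_deg_sym N f g : eq_mod_deg N f g -> eq_mod_deg N g f.
Proof. by move=> fg n ltnN; rewrite fg. Qed.

Lemma eq_mod_deg_trans N f g h :
  eq_mod_deg N f g -> eq_mod_deg N g h -> eq_mod_deg N f h.
Proof. by move=> fg gh n ltnN; rewrite fg ?gh. Qed.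

Lemma eq_mod_deg_le M N f g : (M <= N)%N -> eq_mod_deg N f g -> eq_mod_deg M f g.
Proof. by move=> leMN fg n ltnM; apply: fg; apply: leq_trans leMN. Qed.

Lemma eq_mod_degXn k M N f g : (N <= k + M)%N ->
  eq_mod_deg M f g -> eq_mod_deg N (fpsX ^+ k * f) (fpsX ^+ k * g).
Proof.
move=> leN fg n ltnN; rewrite !fcoef_mulXn; case: leqP => // lekn.
by apply: fg; rewrite ltn_subLR // (leq_trans ltnN).
Qed.

Lemma eq_mod_deg_deriv N f g :
  eq_mod_deg N f g -> eq_mod_deg N (fps_deriv f) (fps_deriv g).
Proof. by move=> fg n ltnN /=; rewrite fg. Qed.

Lemma eq_mod_deg_sum N I (r : seq I) (P : pred I) (F G : I -> fps K) :
  (forall i, P i -> eq_mod_deg N (F i) (G i)) ->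
  eq_mod_deg N (\sum_(i <- r | P i) F i) (\sum_(i <- r | P i) G i).
Proof. by move=> FG n ltnN; rewrite !fcoef_sum; apply: eq_bigr => i /FG->. Qed.

Lemma fps_eqP f g : (forall N, eq_mod_deg N f g) -> f = g.
Proof. by move=> fg; apply: fpsP => n; apply: (fg n.+1). Qed.

End Derivation.

(** * Jacobi's identity for the cube of the Euler product *)

Section Jacobi.
Variable K : comNzRingType.
Local Notation q := (@fpsX K).

(** Gaussian binomial coefficients, as power series in [q]. Defining them by
    the [q]-Pascal rule avoids any division. *)
Fixpoint qbin (n k : nat) : fps K :=
  match n, k with
  | _, 0 => 1
  | 0, _.+1 => 0
  | n'.+1, k'.+1 => qbin n' k' + q ^+ k * qbin n' k
  end.

Arguments qbin : simpl never.

Definition qfact (n : nat) : fps K := \prod_(j < n) (1 - q ^+ j.+1).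

Lemma qbin0 n : qbin n 0 = 1.
Proof. by case: n. Qed.

Lemma qbinS n k : qbin n.+1 k.+1 = qbin n k + q ^+ k.+1 * qbin n k.+1.
Proof. by []. Qed.

Lemma qbin_small n k : (n < k)%N -> qbin n k = 0.
Proof.
elim: n k => [|n IHn] [|k] //; rewrite ltnS => lt_nk.
by rewrite qbinS !IHn ?mulr0 ?addr0 // ltnW.
Qed.

Lemma qbinn n : qbin n n = 1.
Proof. by elim: n => [//|n IHn]; rewrite qbinS IHn qbin_small ?mulr0 ?addr0. Qed.

(** The mirror image of the defining [q]-Pascal rule. *)
Lemma qbinSr n k : (k <= n)%N ->
  qbin n.+1 k.+1 = q ^+ (n - k) * qbin n k + qbin n k.+1.
Proof.
elim: n k => [|n IHn] k; first rewrite leqn0 => /eqP->.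
  by rewrite !qbinn [qbin 0 1]qbin_small // addr0 mul1r.
rewrite leq_eqVlt => /predU1P[-> | ].
  by rewrite subnn !qbinn qbin_small // addr0 mul1r.
case: k => [|k] lt_kn.
  rewrite qbinS {1}IHn // !subn0 !qbin0 [qbin n.+1 1]qbinS qbin0 !exprS expr0.
  ring.
rewrite qbinS [qbin n.+1 k.+1 in LHS]IHn 1?ltnW // [qbin n.+1 k.+2 in LHS]IHn //.
rewrite !qbinS subSS; have -> : (n - k = (n - k.+1).+1)%N by lia.
rewrite !exprS; ring.
Qed.

Lemma qbin_sym n k : (k <= n)%N -> qbin n k = qbin n (n - k).
Proof.
elim: n k => [|n IHn] [|k] // le_kn; first by rewrite subn0 qbinn.
move: le_kn; rewrite ltnS leq_eqVlt => /predU1P[-> | lt_kn].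
  by rewrite subnn qbinn.
rewrite qbinS subSS -(subnSK lt_kn) qbinSr ?leq_subr // subKn //.
rewrite -IHn // subnSK // -IHn ?(ltnW lt_kn) //.
ring.
Qed.

Lemma qfactS n : qfact n.+1 = qfact n * (1 - q ^+ n.+1).
Proof. by rewrite /qfact big_ord_recr. Qed.

Lemma qbin_absorb n k : (k <= n)%N ->
  (1 - q ^+ k.+1) * qbin n.+1 k.+1 = (1 - q ^+ n.+1) * qbin n k.
Proof.
move=> le_kn; rewrite mulrBl mul1r {1}qbinS qbinSr // mulrDr mulrA -exprD.
rewrite addSn subnKC //; ring.
Qed.

(** By [qbin_absorb] the product equals [(1-q^(n-k+1)) ... (1-q^n)], so it
    tends to [1] when [n] grows with [k] fixed. *)
Lemma qfact_qbin_approx n k : (k <= n)%N ->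
  eq_mod_deg (n - k).+1 (qfact k * qbin n k) 1.
Proof.
elim: k n => [|k IHk] [|n] // le_kn i lt_i; rewrite ?qbin0 ?mulr1.
- by rewrite /qfact big_ord0.
- by rewrite /qfact big_ord0.
have -> : qfact k.+1 * qbin n.+1 k.+1 = (1 - q ^+ n.+1) * (qfact k * qbin n k).
  by rewrite qfactS -mulrA qbin_absorb // mulrCA.
have lt_i' : (i < (n - k).+1)%N by rewrite subSS in lt_i.
rewrite mulrBl mul1r; transitivity (fcoef (qfact k * qbin n k) i); last exact: IHk.
rewrite fcoefB fcoef_mulXn.
by rewrite (_ : (n < i)%N = false) ?subr0 //; lia.
Qed.

Lemma qfact_approx m n : (m <= n)%N -> eq_mod_deg m.+1 (qfact n) (qfact m).
Proof.
move=> /subnK <-; elim: (n - m)%N => [//|d IHd] i lt_i.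
rewrite addSn qfactS mulrBr mulr1 [_ * q ^+ _]mulrC.
transitivity (fcoef (qfact (d + m)) i); last exact: IHd.
rewrite fcoefB fcoef_mulXn.
by rewrite (_ : (d + m < i)%N = false) ?subr0 //; lia.
Qed.

Definition tri (k : nat) : nat := (k * k.+1)./2.

Arguments tri : simpl never.

Lemma triS k : tri k.+1 = (tri k + k.+1)%N.
Proof.
rewrite /tri (_ : k.+1 * k.+2 = k * k.+1 + k.+1.*2)%N; last by lia.
by rewrite halfD odd_double doubleK andbF.
Qed.

(** Up to sign, the coefficient of [z^(k+1)], and also that of [z^(-k)], in the
    finite triple product
    [prod_(0<=j<=n) (1 - z q^j) * prod_(1<=j<=n) (1 - z^(-1) q^j)]. *)
Definition gauss_term (n k : nat) : fps K :=
  if (k <= n)%N then q ^+ tri k * qbin (2 * n).+1 (n - k) else 0.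

(** The defining rule followed by its mirror image: the three terms are the
    ones of the recursion [gauss_termS]. *)
Lemma qbinSS N m : (m <= N)%N ->
  qbin N.+2 m.+1 = (1 + q ^+ N.+1) * qbin N m
    + (if m is m'.+1 then q ^+ (N - m') * qbin N m' else 0)
    + q ^+ m.+1 * qbin N m.+1.
Proof.
move=> le_mN; rewrite qbinS [qbin N.+1 m.+1]qbinSr // mulrDr mulrA -exprD.
rewrite addSn subnKC //; case: m le_mN => [|m] le_mN; first by rewrite !qbin0; ring.
rewrite [qbin N.+1 m.+1]qbinSr 1?ltnW //; ring.
Qed.

(** Effect on coefficients of multiplying the finite triple product by
    [(1 - z q^(n+1)) (1 - z^(-1) q^(n+1))]. At [k = 0] the truncated predecessor
    gives the right answer, because the coefficients of [z] and [z^0] agree up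
    to sign. *)
Lemma gauss_termS n k : (k <= n.+1)%N ->
  gauss_term n.+1 k = (1 + q ^+ n.+1 ^+ 2) * gauss_term n k
    + q ^+ n.+1 * (gauss_term n k.+1 + gauss_term n k.-1).
Proof.
have two : (2 * n.+1 = (2 * n).+2)%N by rewrite mulnS.
rewrite leq_eqVlt /gauss_term => /predU1P[-> | ].
  rewrite (_ : (n.+1 < n)%N = false); last by lia.
  by rewrite !ltnn /= !leqnn !subnn !qbin0 triS exprD; ring.
rewrite ltnS => le_kn.
have le_k'n : (k.-1 <= n)%N by rewrite (leq_trans (leq_pred k)).
have le_nk : (n - k <= (2 * n).+1)%N.
  by rewrite (leq_trans (leq_subr _ _)) // mul2n -addnn leqW ?leq_addr.
rewrite le_kn le_k'n leqW // subSn // two qbinSS // -exprM [(n.+1 * 2)%N]mulnC two.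
rewrite 2!mulrDr [q ^+ n.+1 * (_ + _)]mulrDr; set N := (2 * n).+1.
have -> : q ^+ tri k * (if (n - k)%N is m'.+1 then q ^+ (N - m') * qbin N m' else 0)
    = q ^+ n.+1 * (if (k < n)%N then q ^+ tri k.+1 * qbin N (n - k.+1) else 0).
  case: ltnP => [lt_kn | le_nk']; last by rewrite (eqP le_nk') !mulr0.
  rewrite -(subnSK lt_kn) !mulrA -!exprD; congr (q ^+ _ * _).
  rewrite triS /N; move: (tri k) => t; lia.
have -> : q ^+ tri k * (q ^+ (n - k).+1 * qbin N (n - k).+1)
    = q ^+ n.+1 * (q ^+ tri k.-1 * qbin N (n - k.-1)).
  case: k le_kn {le_k'n le_nk} => [|k] lt_kn.
    rewrite /= subn0 [qbin N n]qbin_sym /N; last by lia.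
    by rewrite mulrCA; congr (_ * (_ * qbin _ _)); lia.
  rewrite subnSK //= !mulrA -!exprD; congr (q ^+ _ * _).
  rewrite triS; move: (tri k) => t; lia.
ring.
Qed.

Definition jacobi_coef (k : nat) : fps K := (-1) ^+ k * (2 * k + 1)%:R.

Lemma jacobi_coefSS k : jacobi_coef k + jacobi_coef k.+2 = - 2%:R * jacobi_coef k.+1.
Proof. by rewrite /jacobi_coef !natrD !natrM !exprS -!natr1; ring. Qed.

(** Both sides are, up to sign, the derivative at [z = 1] of the finite triple
    product. Concretely, the weights satisfy [w (k-1) + w (k+1) = - 2 w k] by
    [jacobi_coefSS], so that the recursion [gauss_termS] multiplies the weighted
    sum by [(1 + q^(2n+2)) - 2 q^(n+1) = (1 - q^(n+1))^2]. *)
Lemma sum_gauss_term n :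
  \sum_(k < n.+1) jacobi_coef k * gauss_term n k = qfact n ^+ 2.
Proof.
elim: n => [|n IHn].
  rewrite big_ord1 /gauss_term /qfact big_ord0 subnn qbin0 /jacobi_coef /tri /=.
  by rewrite !expr0 !mul1r expr1n.
pose S := \sum_(k < n.+1) jacobi_coef k * gauss_term n k.
have beyond : gauss_term n n.+1 = 0 by rewrite /gauss_term ltnn.
transitivity ((1 + q ^+ n.+1 ^+ 2) * S
    + q ^+ n.+1 * (\sum_(k < n.+2) jacobi_coef k * gauss_term n k.+1
                   + \sum_(k < n.+2) jacobi_coef k * gauss_term n k.-1)).
  have -> : S = \sum_(k < n.+2) jacobi_coef k * gauss_term n k.
    by rewrite big_ord_recr /= beyond mulr0 addr0.
  rewrite -big_split !mulr_sumr -big_split; apply: eq_bigr => k _ /=.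
  rewrite gauss_termS; first by ring.
  by rewrite -ltnS.
have -> : \sum_(k < n.+2) jacobi_coef k * gauss_term n k.+1
          = \sum_(k < n) jacobi_coef k * gauss_term n k.+1.
  rewrite !big_ord_recr /= beyond.
  have -> : gauss_term n n.+2 = 0.
    by rewrite /gauss_term (_ : (n.+1 < n)%N = false) //; lia.
  by rewrite !mulr0 !addr0.
have -> : \sum_(k < n.+2) jacobi_coef k * gauss_term n k.-1
   = jacobi_coef 0 * gauss_term n 0 + jacobi_coef 1 * gauss_term n 0
     + \sum_(k < n) jacobi_coef k.+2 * gauss_term n k.+1.
  by rewrite !big_ord_recl /= addrA.
(* The boundary term has weight [1 - 3 = -2], which completes the sum from
   [k = 0] on. *)
rewrite addrCA -big_split /=.
under eq_bigr do rewrite -mulrDl jacobi_coefSS -mulrA.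
rewrite -mulr_sumr.
have -> : \sum_(k < n) jacobi_coef k.+1 * gauss_term n k.+1 = S - gauss_term n 0.
  rewrite /S big_ord_recl {2}/jacobi_coef expr0 !mul1r /=; ring.
rewrite /jacobi_coef expr0 expr1 /= -/S /S IHn qfactS; ring.
Qed.

Definition jacobi_series : fps K :=
  fps_sum (fun k => ((-1) ^+ k * (2 * k + 1)%:R) *: q ^+ tri k).

Lemma leq_tri k : (k <= tri k)%N.
Proof. by case: k => [//|k]; rewrite triS leq_addl. Qed.

Lemma jacobi_series_approx n :
  eq_mod_deg n (jacobi_series) (\sum_(k < n) jacobi_coef k * q ^+ tri k).
Proof.
refine (eq_mod_deg_trans (fps_sumE _) _).
  move=> k i lt_ik /=; rewrite if_same fcoefXn.
  by rewrite ltn_eqF ?mulr0 // (leq_trans lt_ik (leq_tri k)).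
have sgnE k f : ((-1) ^+ k * (2 * k + 1)%:R) *: f = jacobi_coef k * f.
  rewrite /jacobi_coef -!mulrA mulr_natl -scaler_nat -scalerA.
  rewrite -signr_odd -[in RHS]signr_odd; case: (odd k).
    by rewrite !expr1 scaleN1r mulN1r.
  by rewrite !expr0 scale1r mul1r.
by move=> i lt_i; under eq_bigr do rewrite sgnE.
Qed.

(** Multiply [sum_gauss_term] by [qfact n]. Each [q]-binomial becomes
    [1 + O(q^(n-k+1))], and its factor [q^(k(k+1)/2)] with [k <= k(k+1)/2] pushes
    the error beyond [q^n]. *)
Lemma jacobi_identity n : eq_mod_deg n.+1 jacobi_series (qfact n ^+ 3).
Proof.
refine (eq_mod_deg_trans (@jacobi_series_approx n.+1) _); apply: eq_mod_deg_sym.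
rewrite exprS -sum_gauss_term mulr_sumr; apply: eq_mod_deg_sum => k _.
have le_kn : (k <= n)%N by rewrite -ltnS.
rewrite mulrCA; apply: eq_mod_degM => //.
rewrite /gauss_term le_kn mulrCA -[X in eq_mod_deg _ _ X]mulr1.
apply: (@eq_mod_degXn _ (tri k) (n - k).+1).
  by have := leq_tri k; lia.
apply: (@eq_mod_deg_trans _ _ _ (qfact (n - k) * qbin (2 * n).+1 (n - k))).
  by apply: eq_mod_degM => //; apply: qfact_approx; apply: leq_subr.
apply: eq_mod_deg_le (qfact_qbin_approx _); lia.
Qed.

End Jacobi.

(** * Logarithmic derivative of Jacobi's product *)

(** The bound [N] is free so that the divisors of all the [n <= N] can be read
    off one range of indices. *)
Lemma divisorsE N n : (0 < n <= N)%N ->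
  perm_eq (divisors n) [seq d <- index_iota 1 N.+1 | (d %| n)%N].
Proof.
move=> /andP[n_gt0 le_nN].
apply: uniq_perm; rewrite ?divisors_uniq ?filter_uniq ?iota_uniq //.
move=> d; rewrite -dvdn_divisors // mem_filter mem_index_iota.
case dvd_dn: (d %| n)%N => //=; rewrite ltnS.
by rewrite (leq_trans (dvdn_leq n_gt0 dvd_dn)) // (dvdn_gt0 n_gt0 dvd_dn).
Qed.

Section LogDerivative.
Variable K : comNzRingType.
Local Notation q := (@fpsX K).

(** The expansion of [j q^j / (1 - q^j)]. *)
Definition lambert (j : nat) : fps K :=
  Fps (fun n => if (0 < n)%N && (j %| n)%N then j%:R else 0).

Lemma lambertE j : (0 < j)%N -> (1 - q ^+ j) * lambert j = j%:R * q ^+ j.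
Proof.
move=> j_gt0; apply: fpsP => n.
rewrite mulrBl mul1r fcoefB fcoef_mulXn fcoef_natmul fcoefXn /=.
case: (ltngtP n j) => [lt_nj | lt_jn | ->].
- case: posnP => [|n_gt0] /=; first by rewrite subr0 mulr0.
  by rewrite gtnNdvd // subr0 mulr0.
- rewrite subn_gt0 lt_jn dvdn_subl ?(ltnW lt_jn) // (ltn_trans j_gt0 lt_jn) /=.
  by rewrite subrr mulr0.
- by rewrite subnn j_gt0 dvdnn /= subr0 mulr1.
Qed.

Lemma deriv_qfact n :
  fps_deriv (qfact K n) = - (qfact K n * \sum_(j < n) lambert j.+1).
Proof.
elim: n => [|n IHn]; first by rewrite /qfact !big_ord0 fps_deriv1 mulr0 oppr0.
rewrite qfactS fps_derivM IHn fps_derivD fps_derivN fps_deriv1 fps_derivXn.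
rewrite -lambertE // big_ord_recr /=; ring.
Qed.

End LogDerivative.

Lemma fcoef_sigma_series (R : realType) k n :
  fcoef (sigma_series R k) n = if n == 0%N then 0 else (sigma k n)%:R.
Proof.
rewrite /sigma_series /= fcoef_sum big_ord_recr /= big1 ?add0r.
  by case: eqP => _ /=; rewrite ?if_same // fcoefXn eqxx mulr1.
move=> i _; case: eqP => _; first by rewrite fcoef0.
by rewrite /= fcoefXn gtn_eqF ?mulr0.
Qed.

Lemma sum_lambert_approx (R : realType) n :
  eq_mod_deg n.+1 (\sum_(j < n) lambert R[i] j.+1) (sigma_series R 1).
Proof.
move=> m lt_mn; rewrite fcoef_sum fcoef_sigma_series /=.
case: posnP => [-> | m_gt0] /=; first by rewrite big1.
have m_bounds : (0 < m <= n)%N by rewrite m_gt0 -ltnS.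
rewrite /sigma (perm_big _ (divisorsE m_bounds)) big_filter natr_sum.
rewrite [RHS]big_mkcond big_add1 big_mkord; apply: eq_bigr => i _.
by rewrite expn1.
Qed.

(** Modulo [q^(n+1)] the series is [qfact n ^+ 3], whose logarithmic derivative
    is a sum of Lambert terms; these add up to the divisor sums. *)
Lemma deriv_jacobi_series (R : realType) :
  fps_deriv (jacobi_series R[i])
    = - (3%:R * sigma_series R 1 * jacobi_series R[i]).
Proof.
apply: fps_eqP => n; apply: (@eq_mod_deg_le _ n n.+1) => //.
have jacobi := @jacobi_identity R[i] n.
refine (eq_mod_deg_trans (eq_mod_deg_deriv jacobi) _).
have -> : fps_deriv (qfact R[i] n ^+ 3)
    = - (3%:R * (\sum_(j < n) lambert R[i] j.+1) * qfact R[i] n ^+ 3).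
  by rewrite !exprS expr0 mulr1 !fps_derivM deriv_qfact; ring.
have mod_sigma := @eq_mod_degM _ _ (- 3%:R) _ _ _ (fun _ _ => erefl)
  (@sum_lambert_approx R n).
rewrite -!mulNr; exact: eq_mod_degM mod_sigma (eq_mod_deg_sym jacobi).
Qed.

(** * Liouville's elementary method *)

Lemma big_seq_bij (K : nmodType) (T : eqType) (s : seq T) (P Q : pred T)
    (phi psi : T -> T) (F : T -> K) :
    uniq s ->
    {in s, forall t, P t -> [/\ phi t \in s, Q (phi t) & psi (phi t) = t]} ->
    {in s, forall t, Q t -> [/\ psi t \in s, P (psi t) & phi (psi t) = t]} ->
  \sum_(t <- s | Q t) F t = \sum_(t <- s | P t) F (phi t).
Proof.
move=> uniq_s phiP psiP.
rewrite -big_filter -[RHS]big_filter -[RHS](big_map phi xpredT F).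
apply/perm_big/uniq_perm; rewrite ?filter_uniq //.
  rewrite map_inj_in_uniq ?filter_uniq // => t u.
  rewrite !mem_filter => /andP[Pt st] /andP[Pu su] eq_tu.
  by have [_ _ <-] := phiP t st Pt; have [_ _ <-] := phiP u su Pu; rewrite eq_tu.
move=> t; apply/idP/mapP.
  rewrite mem_filter => /andP[Qt st]; have [? ? ?] := psiP t st Qt.
  by exists (psi t); rewrite // mem_filter; apply/andP.
case=> u; rewrite mem_filter => /andP[Pu su] ->.
by have [? ? _] := phiP u su Pu; rewrite mem_filter; apply/andP.
Qed.

Lemma codivisor_gt0 n d : (0 < n)%N -> (d %| n)%N -> (0 < n %/ d)%N.
Proof.
move=> n_gt0 d_n; rewrite divn_gt0 ?(dvdn_gt0 n_gt0 d_n) //.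
exact: dvdn_leq d_n.
Qed.

Local Notation quad := (nat * nat * nat * nat)%type.

(** The quadruples [(a, b, x, y)] of positive integers with
    [a x + b y = n]; see [mem_reps]. Listing them by [m = a x], a divisor [a] of
    [m] and a divisor [b] of [n - m] makes the sums over them convolutions of
    divisor sums. *)
Definition reps (n : nat) : seq quad :=
  [seq (p.2, b, p.1 %/ p.2, (n - p.1) %/ b)%N
     | p <- [seq (m, a) | m <- index_iota 1 n, a <- divisors m],
       b <- divisors (n - p.1)].

Lemma mem_reps n a b x y :
  ((a, b, x, y) \in reps n) =
    [&& 0 < a, 0 < b, 0 < x, 0 < y & a * x + b * y == n]%N.
Proof.
apply/allpairsPdep/and5P => [[[m a'] [b' []]] | [a_gt0 b_gt0 x_gt0 y_gt0 /eqP nE]].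
  case/allpairsPdep=> m' [a'' []]; rewrite mem_index_iota => /andP[m_gt0 lt_mn].
  move=> a_m [-> ->] /= b_nm [-> -> -> ->] {m a' a b x y}.
  have nm_gt0 : (0 < n - m')%N by rewrite subn_gt0.
  rewrite -dvdn_divisors // in a_m; rewrite -dvdn_divisors // in b_nm.
  have a_gt0 := dvdn_gt0 m_gt0 a_m; have b_gt0 := dvdn_gt0 nm_gt0 b_nm.
  split; [exact: a_gt0 | exact: b_gt0 | | | ].
  - exact: codivisor_gt0 a_m.
  - exact: codivisor_gt0 b_nm.
  - by rewrite mulnC divnK // mulnC divnK // subnKC // ltnW.
have ax_gt0 : (0 < a * x)%N by rewrite muln_gt0 a_gt0.
have by_gt0 : (0 < b * y)%N by rewrite muln_gt0 b_gt0.
have nE' : (n - a * x = b * y)%N by rewrite -nE addKn.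
exists (a * x, a)%N, b; split => /=.
- apply/allpairsPdep; exists (a * x)%N, a; split => //.
    by rewrite mem_index_iota ax_gt0 -nE -addn1 leq_add2l.
  by rewrite -dvdn_divisors // dvdn_mulr.
- by rewrite nE' -dvdn_divisors // dvdn_mulr.
- by rewrite nE' !mulKn.
Qed.

Lemma uniq_reps n : uniq (reps n).
Proof.
apply: allpairs_uniq_dep => [|p _|]; last 1 first.
- move=> _ _ /allpairsPdep[[m a] [b [p1 b1 ->]]] /allpairsPdep[[m' a'] [b' [p2 b2 ->]]] /=.
  case/allpairsPdep: p1 b1 => [m0 [a0 [m_n a_m [-> ->]]]] /= b_nm {m a}.
  case/allpairsPdep: p2 b2 => [m1 [a1 [m_n' a_m' [-> ->]]]] /= b_nm' {m' a'}.
  move=> [eqa eqb eqx _]; move: a_m' b_nm' eqx; rewrite -eqa -eqb => a_m' b_nm' eqx.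
  have gt0 k : k \in index_iota 1 n -> (0 < k)%N by rewrite mem_index_iota => /andP[].
  rewrite -!dvdn_divisors ?gt0 // in a_m a_m'.
  by rewrite -(divnK a_m) eqx divnK.
- apply: allpairs_uniq_dep (iota_uniq _ _) _ _ => [m _|]; first exact: divisors_uniq.
  by move=> [m a] [m' a'] _ _ /= [-> ->].
- exact: divisors_uniq.
Qed.

Definition qsum (K : nmodType) n (P : nat -> nat -> nat -> nat -> bool)
    (h : nat -> nat -> nat -> nat -> K) : K :=
  \sum_(t <- reps n | let: (a, b, x, y) := t in P a b x y)
     let: (a, b, x, y) := t in h a b x y.

Section Liouville.
Variable K : comNzRingType.
Implicit Types (h : nat -> nat -> nat -> nat -> K).
Implicit Types (P : nat -> nat -> nat -> nat -> bool).

Lemma eq_qsum n P h h' :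
    (forall a b x y, (0 < a)%N -> (0 < b)%N -> P a b x y -> h a b x y = h' a b x y) ->
  qsum n P h = qsum n P h'.
Proof.
move=> hh'; rewrite /qsum big_seq_cond [RHS]big_seq_cond.
apply: eq_bigr => -[[[a b] x] y].
by rewrite mem_reps => /andP[/and5P[a_gt0 b_gt0 _ _ _] Pt]; apply: hh'.
Qed.

Lemma qsum_swap n P h :
  qsum n P h = qsum n (fun a b x y => P b a y x) (fun a b x y => h b a y x).
Proof.
pose swap (t : quad) := let: (a, b, x, y) := t in (b, a, y, x).
rewrite /qsum (@big_seq_bij _ _ _ (fun t => let: (a, b, x, y) := t in P b a y x)
  _ swap swap) ?uniq_reps //.
- by apply: eq_bigr => -[[[a b] x] y].
- move=> [[[a b] x] y]; rewrite !mem_reps /= => /and5P[? ? ? ? /eqP<-] ?.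
  by rewrite addnC; split => //; apply/and5P.
- move=> [[[a b] x] y]; rewrite !mem_reps /= => /and5P[? ? ? ? /eqP<-] ?.
  by rewrite addnC; split => //; apply/and5P.
Qed.

(** The engine of the method: since [(a - b) x + b (x + y) = a x + b y], the map
    [(a, b, x, y) |-> (a - b, b, x, x + y)] is a bijection from the solutions
    with [b < a] onto those with [x < y]. *)
Lemma qsum_shear n h :
  qsum n (fun a b x y => x < y)%N h
    = qsum n (fun a b x y => b < a)%N (fun a b x y => h (a - b)%N b x (x + y)%N).
Proof.
pose phi (t : quad) := let: (a, b, x, y) := t in ((a - b)%N, b, x, (x + y)%N).
pose psi (t : quad) := let: (a, b, x, y) := t in ((a + b)%N, b, x, (y - x)%N).
rewrite /qsum (@big_seq_bij _ _ _ (fun t => let: (a, b, x, y) := t in b < a)%N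
  _ phi psi) ?uniq_reps //.
- by apply: eq_bigr => -[[[a b] x] y].
- move=> [[[a b] x] y]; rewrite !mem_reps /= => /and5P[? ? ? ? /eqP<-] lt_ba.
  split; last by rewrite subnK ?addKn // ltnW.
    by apply/and5P; split=> //; [lia | lia | apply/eqP; nia].
  by rewrite -addn1 leq_add2l.
- move=> [[[a b] x] y]; rewrite !mem_reps /= => /and5P[? ? ? ? /eqP<-] lt_xy.
  split; last by rewrite addnK subnKC // ltnW.
    by apply/and5P; split=> //; [lia | lia | apply/eqP; nia].
  by rewrite -addn1 addnC leq_add2r.
Qed.

Lemma qsum_trichotomy n (f g : nat -> nat -> nat -> nat -> nat) h :
  qsum n (fun _ _ _ _ => true) h
    = qsum n (fun a b x y => f a b x y < g a b x y)%N h
      + qsum n (fun a b x y => g a b x y < f a b x y)%N h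
      + qsum n (fun a b x y => f a b x y == g a b x y) h.
Proof.
rewrite /qsum (big_mkcond (fun t => let: (a, b, x, y) := t in f a b x y < g a b x y)%N).
rewrite (big_mkcond (fun t => let: (a, b, x, y) := t in g a b x y < f a b x y)%N).
rewrite (big_mkcond (fun t => let: (a, b, x, y) := t in f a b x y == g a b x y)).
rewrite [LHS]big_mkcond -!big_split; apply: eq_bigr => -[[[a b] x] y] _ /=.
by case: ltngtP; rewrite ?add0r ?addr0.
Qed.

(** With [x = y] the equation reads [(a + b) x = n]: sum over [d = a + b]. *)
Lemma qsum_diag_xy n (g : nat -> nat -> K) : (0 < n)%N ->
  qsum n (fun a b x y => x == y) (fun a b x y => g a b)
    = \sum_(d <- divisors n) \sum_(1 <= l < d) g l (d - l)%N.
Proof.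
move=> n_gt0.
transitivity (\sum_(t <- [seq (l, d - l, n %/ d, n %/ d)%N
     | d <- divisors n, l <- index_iota 1 d]) let: (a, b, x, y) := t in g a b).
  rewrite /qsum -big_filter; apply/perm_big/uniq_perm; rewrite ?filter_uniq ?uniq_reps //.
    apply: allpairs_uniq_dep (divisors_uniq n) _ _ => [d _|]; first exact: iota_uniq.
    move=> _ _ /allpairsPdep[d [l [_ l_d ->]]] /allpairsPdep[d' [l' [_ l_d' ->]]] /=.
    case=> eq_l; rewrite {}eq_l in l_d *; move: l_d l_d'; rewrite !mem_index_iota.
    move=> ? ? eq_dl _; have -> // : d = d'; lia.
  move=> [[[a b] x] y]; rewrite mem_filter mem_reps.
  apply/andP/allpairsPdep => [[/eqP-> /and5P[? ? ? ? /eqP<-]] | [d [l]]].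
    exists (a + b)%N, a; rewrite -mulnDl -dvdn_divisors ?dvdn_mulr ?muln_gt0 ?addn_gt0 //; last lia.
    rewrite mem_index_iota addKn mulKn ?addn_gt0; last by lia.
    by split => //; lia.
  rewrite mem_index_iota -dvdn_divisors // => -[d_n /andP[l_gt0 lt_ld] [-> -> -> ->]].
  rewrite eqxx -mulnDl subnKC ?(ltnW lt_ld) // [(d * _)%N]mulnC divnK // eqxx l_gt0.
  by rewrite subn_gt0 lt_ld codivisor_gt0.
by rewrite big_allpairs_dep.
Qed.

(** With [a = b = d] there remains [x + y = n / d]. *)
Lemma qsum_diag_ab n (g : nat -> K) : (0 < n)%N ->
  qsum n (fun a b x y => a == b) (fun a b x y => g b)
    = \sum_(d <- divisors n) (n %/ d).-1%:R * g d.
Proof.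
move=> n_gt0.
transitivity (\sum_(t <- [seq (d, d, x, n %/ d - x)%N
     | d <- divisors n, x <- index_iota 1 (n %/ d)]) let: (a, b, x, y) := t in g b).
  rewrite /qsum -big_filter; apply/perm_big/uniq_perm; rewrite ?filter_uniq ?uniq_reps //.
    apply: allpairs_uniq_dep (divisors_uniq n) _ _ => [d _|]; first exact: iota_uniq.
    by move=> [d x] [d' x'] _ _ [-> _ ->].
  move=> [[[a b] x] y]; rewrite mem_filter mem_reps.
  apply/andP/allpairsPdep => [[/eqP-> /and5P[? ? ? ? /eqP<-]] | [d [z]]].
    exists b, x; rewrite -mulnDr -dvdn_divisors ?dvdn_mulr ?muln_gt0 ?addn_gt0 //; last lia.
    rewrite mem_index_iota mulKn // addKn; split => //; lia.
  rewrite mem_index_iota -dvdn_divisors // => -[d_n /andP[z_gt0 lt_z] [-> -> -> ->]].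
  rewrite eqxx -mulnDr subnKC ?(ltnW lt_z) // [(d * _)%N]mulnC divnK // eqxx z_gt0.
  by rewrite subn_gt0 lt_z (dvdn_gt0 n_gt0).
rewrite big_allpairs_dep; apply: eq_bigr => d _.
by rewrite sumr_const_nat subn1 mulr_natl.
Qed.

(** Split the sum of [g (a, b)] by the order of [x] and [y], and that of
    [g (a - b, b)] by the order of [a] and [b]. The shear, used directly and
    conjugated by the exchange of [(a, x)] and [(b, y)], identifies the
    off-diagonal parts; the symmetry hypothesis on [g] makes the second one
    match. Only the two diagonals survive; adding the term [l = 0] to the first
    turns the factor [n / d - 1] of the second into [n / d]. *)
Lemma liouville_identity n (g : K -> K -> K) : (0 < n)%N ->
    (forall a b, g (a - b) b = g a (b - a)) ->
  qsum n (fun _ _ _ _ => true)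
      (fun a b _ _ => g a%:R b%:R - g (a%:R - b%:R) b%:R)
    = \sum_(d <- divisors n)
        (\sum_(l < d) g l%:R (d%:R - l%:R) - (n %/ d)%:R * g 0 d%:R).
Proof.
move=> n_gt0 g_sym.
pose G (a b : nat) (_ _ : nat) := g a%:R b%:R.
pose G' (a b : nat) (_ _ : nat) := g (a%:R - b%:R) b%:R.
have -> : qsum n (fun _ _ _ _ => true) (fun a b _ _ => g a%:R b%:R - g (a%:R - b%:R) b%:R)
  = qsum n (fun _ _ _ _ => true) G - qsum n (fun _ _ _ _ => true) G'.
  by rewrite /qsum -sumrB; apply: eq_bigr => -[[[a b] x] y].
rewrite (qsum_trichotomy n (fun _ _ x _ => x) (fun _ _ _ y => y) G).
rewrite (qsum_trichotomy n (fun a _ _ _ => a) (fun _ b _ _ => b) G').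
have -> : qsum n (fun _ _ x y => x < y)%N G = qsum n (fun a b _ _ => b < a)%N G'.
  rewrite qsum_shear; apply: eq_qsum => a b x y _ _ lt_ba.
  by rewrite /G natrB // ltnW.
have -> : qsum n (fun _ _ x y => y < x)%N G = qsum n (fun a b _ _ => a < b)%N G'.
  rewrite qsum_swap qsum_shear [LHS]qsum_swap; apply: eq_qsum => a b x y _ _ lt_ab.
  by rewrite /G /G' natrB ?(ltnW lt_ab) // g_sym.
rewrite (qsum_diag_xy _ n_gt0).
have -> : qsum n (fun a b _ _ => a == b) G'
    = qsum n (fun a b _ _ => a == b) (fun _ b _ _ => g 0 b%:R).
  by apply: eq_qsum => a b x y _ _ /eqP->; rewrite /G' subrr.
rewrite (qsum_diag_ab (fun b => g 0 b%:R)) //.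
have cancel (u v s t : K) : u + v + s - (v + u + t) = s - t by ring.
rewrite cancel -sumrB; apply: eq_big_seq => d; rewrite -dvdn_divisors // => d_n.
have d_gt0 := dvdn_gt0 n_gt0 d_n.
have nd_gt0 := codivisor_gt0 n_gt0 d_n.
rewrite -(big_mkord xpredT (fun l => g l%:R (d%:R - l%:R))) big_ltn // subr0.
have -> : \sum_(1 <= l < d) g l%:R (d - l)%N%:R
    = \sum_(1 <= l < d) g l%:R (d%:R - l%:R).
  by apply: eq_big_nat => l /andP[_ lt_ld]; rewrite natrB // ltnW.
have -> : (n %/ d)%:R = (n %/ d).-1%:R + 1 :> K by rewrite natr1 prednK.
ring.
Qed.

End Liouville.

(** * Power sums *)

Section PowerSums.
Variable K : numFieldType.
Implicit Types (x d : K).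

Lemma sum_antidiff n (f : 'I_n -> K) (Q : K -> K) :
    Q 0 = 0 -> (forall l : 'I_n, Q l.+1%:R - Q l%:R = f l) ->
  \sum_(l < n) f l = Q n%:R.
Proof.
move=> Q0 dQ; under eq_bigr => l _ do rewrite -dQ.
by rewrite -(big_mkord xpredT (fun l => Q l.+1%:R - Q l%:R)) telescope_sumr // Q0 subr0.
Qed.

(** The polynomial with suffix [r] is the one that vanishes at [0] and has forward
    difference [x ^+ r]; the symmetric sums below also need its reflection, since
    [B (d + 1) - B (d + 1 - x)] has forward difference [(d - x) ^+ r] if [B] is the
    one with suffix [r]. *)
Definition faulhaber1 x := x ^+ 2 / 2%:R - x / 2%:R.
Definition faulhaber2 x := x ^+ 3 / 3%:R - x ^+ 2 / 2%:R + x / 6%:R.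
Definition faulhaber4 x :=
  x ^+ 5 / 5%:R - x ^+ 4 / 2%:R + x ^+ 3 / 3%:R - x / 30%:R.
Definition faulhaber5 x :=
  x ^+ 6 / 6%:R - x ^+ 5 / 2%:R + 5%:R * x ^+ 4 / 12%:R - x ^+ 2 / 12%:R.
Definition faulhaber6 x :=
  x ^+ 7 / 7%:R - x ^+ 6 / 2%:R + x ^+ 5 / 2%:R - x ^+ 3 / 6%:R + x / 42%:R.

Lemma sum_sym2 (d : nat) :
  \sum_(l < d) ((l%:R + (d%:R - l%:R)) ^+ 2 + l%:R ^+ 2 + (d%:R - l%:R) ^+ 2)
  = (5%:R * d%:R ^+ 3 + d%:R) / 3%:R :> K.
Proof.
pose D : K := d%:R; pose B := faulhaber2.
rewrite (@sum_antidiff _ _ (fun x => x * D ^+ 2 + B x + B (D + 1) - B (D + 1 - x))).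
- by rewrite -/D /B /faulhaber2; field.
- by rewrite /B /faulhaber2 subr0; ring.
- by move=> l; rewrite -natr1 /B /faulhaber2 -/D; field.
Qed.

Lemma sum_sym4 (d : nat) :
  \sum_(l < d) ((l%:R + (d%:R - l%:R)) ^+ 4 + l%:R ^+ 4 + (d%:R - l%:R) ^+ 4)
  = (21%:R * d%:R ^+ 5 + 10%:R * d%:R ^+ 3 - d%:R) / 15%:R :> K.
Proof.
pose D : K := d%:R; pose B := faulhaber4.
rewrite (@sum_antidiff _ _ (fun x => x * D ^+ 4 + B x + B (D + 1) - B (D + 1 - x))).
- by rewrite -/D /B /faulhaber4; field.
- by rewrite /B /faulhaber4 subr0; ring.
- by move=> l; rewrite -natr1 /B /faulhaber4 -/D; field.
Qed.

Lemma sum_sym6 (d : nat) :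
  \sum_(l < d) ((l%:R + (d%:R - l%:R)) ^+ 6 + l%:R ^+ 6 + (d%:R - l%:R) ^+ 6)
  = (27%:R * d%:R ^+ 7 + 21%:R * d%:R ^+ 5 - 7%:R * d%:R ^+ 3 + d%:R) / 21%:R :> K.
Proof.
pose D : K := d%:R; pose B := faulhaber6.
rewrite (@sum_antidiff _ _ (fun x => x * D ^+ 6 + B x + B (D + 1) - B (D + 1 - x))).
- by rewrite -/D /B /faulhaber6; field.
- by rewrite /B /faulhaber6 subr0; ring.
- by move=> l; rewrite -natr1 /B /faulhaber6 -/D; field.
Qed.

(** With [F x = x ^+ 4] this is [ab F(a + b) - (ab + b^2) F(a) - (ab + a^2) F(b)].
    The difference [g (a, b) - g (a - b, b)] of [liouville_identity] is then
    [ab (F(a + b) + F(a - b) - 2 F(a) - 2 F(b))], the combination that arises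
    when the [q]-expansion of the Weierstrass function is squared; for this [F]
    it is [12 a^3 b^3]. *)
Definition weierstrass_kernel (a b : K) : K :=
  a * b * (a + b) ^+ 4 - (a * b + b ^+ 2) * a ^+ 4 - (a * b + a ^+ 2) * b ^+ 4.

Lemma sum_weierstrass_kernel (d : nat) :
  \sum_(l < d) weierstrass_kernel l%:R (d%:R - l%:R)
  = (d%:R ^+ 7 - d%:R ^+ 3) / 10%:R :> K.
Proof.
(* [H] has forward difference [(D - x) x^4], and reversing the range turns
   [x (D - x)^4] into the same summand. *)
pose D : K := d%:R; pose H x := D * faulhaber4 x - faulhaber5 x.
rewrite (@sum_antidiff _ _ (fun x => D ^+ 4 * (D * faulhaber1 x - faulhaber2 x)
  - D * (H x + H (D + 1) - H (D + 1 - x)))).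
- by rewrite -/D /H /faulhaber1 /faulhaber2 /faulhaber4 /faulhaber5; field.
- by rewrite /H /faulhaber1 /faulhaber2 /faulhaber4 /faulhaber5 subr0; ring.
- move=> l; rewrite -natr1 /weierstrass_kernel /H.
  by rewrite /faulhaber1 /faulhaber2 /faulhaber4 /faulhaber5 -/D; field.
Qed.

End PowerSums.

(** * Convolution sums of divisor functions *)

Section Convolutions.
Variable R : realType.
Local Notation s := (sigma_series R).

Lemma fcoef_sigmaM i j n :
  fcoef (s i * s j) n
    = qsum n (fun _ _ _ _ => true) (fun a b _ _ => a%:R ^+ i * b%:R ^+ j).
Proof.
have -> : fcoef (s i * s j) n = \sum_(1 <= m < n) (sigma i m)%:R * (sigma j (n - m))%:R.
  rewrite fcoefM; under eq_bigr do rewrite !fcoef_sigma_series.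
  rewrite -(big_mkord xpredT (fun m => (if m == 0%N then 0 else (sigma i m)%:R)
    * (if (n - m)%N == 0%N then 0 else (sigma j (n - m))%:R))).
  rewrite big_ltn // eqxx mul0r add0r.
  case: n => [|n]; first by rewrite !big_geq.
  rewrite big_nat_recr //= subnn eqxx mulr0 addr0.
  apply: eq_big_nat => m /andP[m_gt0 lt_mn].
  by rewrite gtn_eqF // subn_eq0 leqNgt lt_mn.
transitivity (\sum_(t <- reps n)
    let: (a, b, x, y) := t in a%:R ^+ i * b%:R ^+ j : R[i]); last first.
  by apply: eq_bigl => -[[[a b] x] y].
rewrite /reps !big_allpairs_dep; apply: eq_big_nat => m _.
rewrite /sigma !natr_sum mulr_suml; apply: eq_bigr => a _.
by rewrite mulr_sumr; apply: eq_bigr => b _; rewrite !natrX.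
Qed.

End Convolutions.

Section SigmaConvolutions.
Variable R : realType.
Local Notation C := R[i].
Local Notation s := (sigma_series R).

Lemma fcoef_sigma_sum k n : (0 < n)%N ->
  fcoef (s k) n = \sum_(d <- divisors n) d%:R ^+ k.
Proof.
move=> n_gt0; rewrite fcoef_sigma_series gtn_eqF // /sigma natr_sum.
by apply: eq_bigr => d _; rewrite natrX.
Qed.

Lemma qsum0 (P : nat -> nat -> nat -> nat -> bool) (h : nat -> nat -> nat -> nat -> C) :
  qsum 0 P h = 0.
Proof. by rewrite /qsum /reps big_nil. Qed.

(** The difference [g (a, b) - g (a - b, b)] of [liouville_identity] is here
    [(a + b)^(2m) - (a - b)^(2m)], a combination of the [a^i b^j] with [i], [j] odd
    and [i + j = 2m]. *)
Definition even_kernel (m : nat) (a b : C) : C :=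
  (a + b) ^+ (2 * m) + a ^+ (2 * m) + b ^+ (2 * m).

Lemma even_kernel_sym m a b : even_kernel m (a - b) b = even_kernel m a (b - a).
Proof.
rewrite /even_kernel !exprM.
have -> : (b - a) ^+ 2 = (a - b) ^+ 2 by ring.
have -> : a - b + b = a by ring.
have -> : a + (b - a) = b by ring.
ring.
Qed.

Lemma codivisorE n d : (0 < n)%N -> d \in divisors n ->
  n%:R = (n %/ d)%:R * d%:R :> C.
Proof. by move=> n_gt0; rewrite -dvdn_divisors // -natrM => /divnK->. Qed.

Lemma sigma_conv_1_1 :
  12%:R * (s 1 * s 1) = 5%:R * s 3 + s 1 - 6%:R * fps_deriv (s 1).
Proof.
apply: fpsP => n; rewrite fcoefB fcoefD !fcoef_natmul fcoef_sigmaM.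
have [-> | n_gt0] := posnP n.
  by rewrite qsum0 ?fcoef_deriv !fcoef_sigma_series /=; ring.
have := liouville_identity n_gt0 (even_kernel_sym 1).
move=> /(congr1 ( *%R 3%:R)) liouville.
transitivity (3%:R * qsum n (fun _ _ _ _ => true) (fun a b _ _ =>
    even_kernel 1 a%:R b%:R - even_kernel 1 (a%:R - b%:R) b%:R)).
  rewrite /qsum !mulr_sumr; apply: eq_bigr => -[[[a b] x] y] _.
  by rewrite /even_kernel; ring.
rewrite {}liouville fcoef_deriv !fcoef_sigma_sum //.
rewrite !mulr_sumr -big_split /= -sumrB; apply: eq_big_seq => d d_n.
rewrite /even_kernel sum_sym2 (codivisorE n_gt0 d_n).
by field.
Qed.

Lemma sigma_conv_1_3 :
  240%:R * (s 1 * s 3)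
    = 21%:R * s 5 + 10%:R * s 3 - s 1 - 30%:R * fps_deriv (s 3).
Proof.
(* The kernel produces the symmetric combination of [a b^3] and [a^3 b]. *)
have halves (u v : fps C) : 240%:R * (u * v) = 120%:R * (u * v) + 120%:R * (v * u).
  by ring.
rewrite [LHS]halves.
apply: fpsP => n; rewrite !fcoefB !fcoefD !fcoef_natmul !fcoef_sigmaM.
have [-> | n_gt0] := posnP n.
  by rewrite !qsum0 ?fcoef_deriv !fcoef_sigma_series /=; ring.
have := liouville_identity n_gt0 (even_kernel_sym 2).
move=> /(congr1 ( *%R 15%:R)) liouville.
transitivity (15%:R * qsum n (fun _ _ _ _ => true) (fun a b _ _ =>
    even_kernel 2 a%:R b%:R - even_kernel 2 (a%:R - b%:R) b%:R)).
  rewrite /qsum !mulr_sumr -big_split; apply: eq_bigr => -[[[a b] x] y] _.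
  by rewrite /even_kernel /=; ring.
rewrite {}liouville fcoef_deriv !fcoef_sigma_sum //.
rewrite !mulr_sumr -big_split /= -!sumrB; apply: eq_big_seq => d d_n.
rewrite /even_kernel sum_sym4 (codivisorE n_gt0 d_n).
by field.
Qed.

Lemma weierstrass_kernel_sym (a b : C) :
  weierstrass_kernel (a - b) b = weierstrass_kernel a (b - a).
Proof. by rewrite /weierstrass_kernel; ring. Qed.

(** In weight [8] the even kernel gives one relation between the two
    convolutions [s 1 * s 5] and [s 3 * s 3]; this one, equivalent to
    [E4^2 = E8], isolates the second. *)
Lemma sigma_conv_3_3 : 120%:R * (s 3 * s 3) = s 7 - s 3.
Proof.
apply: fpsP => n; rewrite !fcoefB !fcoef_natmul !fcoef_sigmaM.
have [-> | n_gt0] := posnP n.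
  by rewrite !qsum0 !fcoef_sigma_series /=; ring.
have := liouville_identity n_gt0 weierstrass_kernel_sym.
move=> /(congr1 ( *%R 10%:R)) liouville.
transitivity (10%:R * qsum n (fun _ _ _ _ => true) (fun a b _ _ =>
    weierstrass_kernel a%:R b%:R - weierstrass_kernel (a%:R - b%:R) b%:R : C)).
  rewrite /qsum !mulr_sumr; apply: eq_bigr => -[[[a b] x] y] _.
  by rewrite /weierstrass_kernel; ring.
rewrite {}liouville !fcoef_sigma_sum //.
rewrite !mulr_sumr -!sumrB /=; apply: eq_big_seq => d d_n.
rewrite sum_weierstrass_kernel /weierstrass_kernel.
by field.
Qed.

Lemma sigma_conv_1_5 :
  504%:R * (s 1 * s 5) + 840%:R * (s 3 * s 3)
    = 27%:R * s 7 + 21%:R * s 5 - 7%:R * s 3 + s 1 - 42%:R * fps_deriv (s 5).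
Proof.
have halves (u v : fps C) : 504%:R * (u * v) = 252%:R * (u * v) + 252%:R * (v * u).
  by ring.
rewrite [X in X + _ = _]halves.
apply: fpsP => n; rewrite !(fcoefB, fcoefD) !fcoef_natmul !fcoef_sigmaM.
have [-> | n_gt0] := posnP n.
  by rewrite !qsum0 ?fcoef_deriv !fcoef_sigma_series /=; ring.
have := liouville_identity n_gt0 (even_kernel_sym 3).
move=> /(congr1 ( *%R 21%:R)) liouville.
transitivity (21%:R * qsum n (fun _ _ _ _ => true) (fun a b _ _ =>
    even_kernel 3 a%:R b%:R - even_kernel 3 (a%:R - b%:R) b%:R)).
  rewrite /qsum !mulr_sumr -big_split /= -big_split /=; apply: eq_bigr => -[[[a b] x] y] _.
  by rewrite /even_kernel /=; ring.
rewrite {}liouville fcoef_deriv !fcoef_sigma_sum //.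
rewrite !mulr_sumr -big_split /= -sumrB -big_split /= -sumrB; apply: eq_big_seq => d d_n.
rewrite /even_kernel sum_sym6 (codivisorE n_gt0 d_n).
by field.
Qed.

(** * Ramanujan's differential equations *)

Lemma E2E : E2 R = 1 - 24%:R * s 1.
Proof. by rewrite /E2 scaler_nat mulr_natl. Qed.

Lemma E4E : E4 R = 1 + 240%:R * s 3.
Proof. by rewrite /E4 scaler_nat mulr_natl. Qed.

Lemma E6E : E6 R = 1 - 504%:R * s 5.
Proof. by rewrite /E6 scaler_nat mulr_natl. Qed.

(** In terms of the divisor series, each differential equation is a linear
    consequence of the convolution identities, in any commutative ring. *)
Lemma ramanujan_E2_algebra (A : comNzRingType) (u v du : A) :
    12%:R * (u * u) = 5%:R * v + u - 6%:R * du ->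
  12%:R * (0 - 24%:R * du) = (1 - 24%:R * u) ^+ 2 - (1 + 240%:R * v).
Proof.
move=> conv; apply: subr0_eq.
transitivity (- 48%:R * (12%:R * (u * u) - (5%:R * v + u - 6%:R * du))); first ring.
by rewrite conv subrr mulr0.
Qed.

Lemma ramanujan_E4_algebra (A : comNzRingType) (u v w dv : A) :
    240%:R * (u * v) = 21%:R * w + 10%:R * v - u - 30%:R * dv ->
  3%:R * (0 + 240%:R * dv)
    = (1 - 24%:R * u) * (1 + 240%:R * v) - (1 - 504%:R * w).
Proof.
move=> conv; apply: subr0_eq.
transitivity (24%:R * (240%:R * (u * v)
  - (21%:R * w + 10%:R * v - u - 30%:R * dv))); first ring.
by rewrite conv subrr mulr0.
Qed.

Lemma ramanujan_E6_algebra (A : comNzRingType) (u v w z dw : A) :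
    120%:R * (v * v) = z - v ->
    504%:R * (u * w) + 840%:R * (v * v)
      = 27%:R * z + 21%:R * w - 7%:R * v + u - 42%:R * dw ->
  2%:R * (0 - 504%:R * dw)
    = (1 - 24%:R * u) * (1 - 504%:R * w) - (1 + 240%:R * v) ^+ 2.
Proof.
move=> conv33 conv15; apply: subr0_eq.
transitivity (648%:R * (120%:R * (v * v) - (z - v))
  - 24%:R * (504%:R * (u * w) + 840%:R * (v * v)
    - (27%:R * z + 21%:R * w - 7%:R * v + u - 42%:R * dw))); first ring.
by rewrite conv15 [in X in X - _]conv33 !subrr !mulr0 subr0.
Qed.

Lemma deriv_E2 : 12%:R * fps_deriv (E2 R) = E2 R ^+ 2 - E4 R.
Proof.
rewrite E2E E4E fps_derivD fps_derivN fps_derivMn fps_deriv1.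
exact: ramanujan_E2_algebra sigma_conv_1_1.
Qed.

Lemma deriv_E4 : 3%:R * fps_deriv (E4 R) = E2 R * E4 R - E6 R.
Proof.
rewrite E2E E4E E6E fps_derivD fps_derivMn fps_deriv1.
exact: ramanujan_E4_algebra sigma_conv_1_3.
Qed.

Lemma deriv_E6 : 2%:R * fps_deriv (E6 R) = E2 R * E6 R - E4 R ^+ 2.
Proof.
rewrite E2E E4E E6E fps_derivD fps_derivN fps_derivMn fps_deriv1.
exact: ramanujan_E6_algebra sigma_conv_3_3 sigma_conv_1_5.
Qed.

End SigmaConvolutions.

(** * Quasimodularity of Ramanujan's series *)

Section RamanujanSeries.
Variable R : realType.
Local Notation C := R[i].
Local Notation D := (@fps_deriv C).
Local Notation A := (ramanujan_num R).

Lemma ramanujan_num1 : A 1 = jacobi_series C.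
Proof. by []. Qed.

Lemma fcoef_ramanujan_num m n :
  fcoef (A m) n
    = \sum_(k < n.+1) (-1) ^+ k * (2 * k + 1)%:R ^+ m * (n == tri k)%:R.
Proof.
rewrite /ramanujan_num /= fcoef_sum; apply: eq_bigr => k _.
by rewrite /= fcoefXn.
Qed.

Lemma ramanujan_num0 m : fcoef (A m) 0 = 1.
Proof.
by rewrite fcoef_ramanujan_num big_ord1 expr0 mul1r expr1n mulr1.
Qed.

(** Because [(2k+1)^2 = 8 k(k+1)/2 + 1]. *)
Lemma ramanujan_numS m : A m.+2 = 8%:R * D (A m) + A m.
Proof.
apply: fpsP => n; rewrite fcoefD fcoef_natmul fcoef_deriv !fcoef_ramanujan_num.
rewrite !mulr_sumr -big_split /=; apply: eq_bigr => k _; move: (k : nat) => {}k.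
case: eqP => [-> | _]; last by rewrite !mulr0 addr0.
have sq : (2 * k + 1)%:R ^+ 2 = 8%:R * (tri k)%:R + 1 :> C.
  rewrite -natrX -natrM natr1; congr _%:R.
  have : ((tri k) * 2 = k * k.+1)%N.
    by rewrite muln2 /tri -[RHS]odd_double_half oddM /= andbN.
  by nia.
rewrite -[m.+2]addn2 exprD sq; ring.
Qed.

Lemma ramanujan_num1_unit : A 1 \is a GRing.unit.
Proof.
by change (fcoef (A 1) 0 \is a GRing.unit); rewrite ramanujan_num0 unitr1.
Qed.

Lemma U0 : U R 0 = 1.
Proof. by rewrite /U divrr ?ramanujan_num1_unit. Qed.

Lemma U_mul n : U R n * A 1 = A (2 * n + 1).
Proof. by rewrite /U divrK ?ramanujan_num1_unit. Qed.

Lemma fcoef_U0 n : fcoef (U R n) 0 = 1.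
Proof.
have /(congr1 (fun f => fcoef f 0)) := U_mul n.
by rewrite fcoefM0 !ramanujan_num0 mulr1.
Qed.

(** Differentiate [U n * A 1 = A (2n+1)]: the logarithmic derivative of [A 1] is
    [-3 sigma_series 1], and [1 - 24 sigma_series 1 = E2]. *)
Lemma U_recursion n : U R n.+1 = 8%:R * D (U R n) + E2 R * U R n.
Proof.
apply: (mulIr ramanujan_num1_unit); rewrite U_mul.
rewrite (_ : 2 * n.+1 + 1 = (2 * n + 1).+2)%N; last by lia.
rewrite ramanujan_numS -U_mul fps_derivM ramanujan_num1 deriv_jacobi_series E2E.
move: (U R n) (jacobi_series C) (D (U R n)) (sigma_series R 1) => u j du s.
ring.
Qed.

(** The index is half the weight. An inductive description, rather than images
    of polynomials, turns stability under [q d/dq] into an induction. *)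
Inductive quasimodular_SL2 : nat -> fps C -> Prop :=
| QM1 : quasimodular_SL2 0 1
| QME2 : quasimodular_SL2 1 (E2 R)
| QME4 : quasimodular_SL2 2 (E4 R)
| QME6 : quasimodular_SL2 3 (E6 R)
| QMD k f g : quasimodular_SL2 k f -> quasimodular_SL2 k g ->
    quasimodular_SL2 k (f + g)
| QMZ k c f : quasimodular_SL2 k f -> quasimodular_SL2 k (c *: f)
| QMM k l f g : quasimodular_SL2 k f -> quasimodular_SL2 l g ->
    quasimodular_SL2 (k + l) (f * g).

Lemma QMN k f : quasimodular_SL2 k f -> quasimodular_SL2 k (- f).
Proof. by move=> qf; rewrite -scaleN1r; apply: QMZ. Qed.

Lemma natmul_scaleP m (f g : fps C) : (0 < m)%N -> m%:R * f = g ->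
  f = m%:R^-1 *: g.
Proof.
move=> m_gt0 <-; rewrite mulr_natl -[f *+ m]scaler_nat scalerA mulVf ?scale1r //.
by rewrite Num.Theory.pnatr_eq0 -lt0n.
Qed.

(** Ramanujan's equations settle the generators; Leibniz' rule does the rest. *)
Lemma quasimodular_SL2_deriv k f :
  quasimodular_SL2 k f -> quasimodular_SL2 k.+1 (D f).
Proof.
elim=> {k f} [|||| k f g _ IHf _ IHg | k c f _ IHf | k l f g qf IHf qg IHg].
- rewrite fps_deriv1 -(scale0r (E2 R)); exact: QMZ QME2.
- rewrite (natmul_scaleP _ (deriv_E2 R)) //; apply: QMZ.
  by apply: QMD; [exact: QMM QME2 QME2 | exact: QMN QME4].
- rewrite (natmul_scaleP _ (deriv_E4 R)) //; apply: QMZ.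
  by apply: QMD; [exact: QMM QME2 QME4 | exact: QMN QME6].
- rewrite (natmul_scaleP _ (deriv_E6 R)) //; apply: QMZ.
  by apply: QMD; [exact: QMM QME2 QME6 | exact/QMN/(QMM QME4 QME4)].
- by rewrite fps_derivD; apply: QMD.
- by rewrite fps_derivZ; apply: QMZ.
- rewrite fps_derivM; apply: QMD; first by rewrite -addSn; apply: QMM.
  by rewrite -addnS; apply: QMM.
Qed.

Lemma quasimodular_SL2_U n : quasimodular_SL2 n (U R n).
Proof.
elim: n => [|n IHn]; first by rewrite U0; apply: QM1.
rewrite U_recursion mulr_natl -[_ *+ 8]scaler_nat; apply: QMD.
  by apply: QMZ; apply: quasimodular_SL2_deriv.
exact: QMM QME2 IHn.
Qed.

(** [quasimodular n] is the case [w = 2 * n]; odd [w] are needed for powers of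
    [theta]. *)
Definition homogeneous2 (w : nat) (f : fps C) : Prop :=
  exists2 P : {mpoly C[4]},
    P \is w.-homog for mnm_weight2 & f = mmap (in_alg (fps C)) (@qm_gen R) P.

Lemma homogeneous2D w f g :
  homogeneous2 w f -> homogeneous2 w g -> homogeneous2 w (f + g).
Proof.
move=> [P hP ->] [Q hQ ->]; exists (P + Q); first exact: rpredD.
by rewrite mmapD.
Qed.

Lemma homogeneous2Z w c f : homogeneous2 w f -> homogeneous2 w (c *: f).
Proof.
move=> [P hP ->]; exists (c *: P); first exact: rpredZ.
by rewrite mmapZ /= mulr_algl.
Qed.

Lemma homogeneous2M v w f g :
  homogeneous2 v f -> homogeneous2 w g -> homogeneous2 (v + w) (f * g).
Proof.
move=> [P hP ->] [Q hQ ->]; exists (P * Q); first exact: dhomogM.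
by rewrite rmorphM.
Qed.

Lemma homogeneous2_1 : homogeneous2 0 1.
Proof. by exists 1; [exact: dhomog1 | rewrite rmorph1]. Qed.

Lemma homogeneous2_gen i : homogeneous2 (qm_weight2 i) (@qm_gen R i).
Proof.
exists 'X_[U_(i)]; last by rewrite mmapX mmap1U.
rewrite dhomogX /= /mnm_weight2 (bigD1 i) //= big1.
  by rewrite mnm1E eqxx mul1n addn0.
by move=> j ne_ji; rewrite mnm1E eq_sym (negbTE ne_ji).
Qed.

Lemma homogeneous2_sum w n (F : 'I_n -> fps C) :
  (forall i, homogeneous2 w (F i)) -> homogeneous2 w (\sum_i F i).
Proof.
move=> hF; elim/big_rec: _ => [|i f _ hf]; last exact: homogeneous2D.
by exists 0; [exact: rpred0 | rewrite mmap0].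
Qed.

Lemma homogeneous2_thetaX k : homogeneous2 k (theta R ^+ k).
Proof.
elim: k => [|k IHk]; first exact: homogeneous2_1.
by rewrite exprS; exact: homogeneous2M (homogeneous2_gen 0) IHk.
Qed.

Lemma homogeneous2_SL2 k f : quasimodular_SL2 k f -> homogeneous2 (4 * k) f.
Proof.
elim=> {k f} [|||| k f g _ IHf _ IHg | k c f _ IHf | k l f g _ IHf _ IHg].
- exact: homogeneous2_1.
- exact: (homogeneous2_gen 1).
- exact: (homogeneous2_gen 2).
- exact: (homogeneous2_gen 3).
- exact: homogeneous2D.
- exact: homogeneous2Z.
- by rewrite mulnDr; apply: homogeneous2M.
Qed.

Lemma fcoef_theta0 : fcoef (theta R) 0 = 1.
Proof.
rewrite /theta /= big_ord1 !fcoefM0 fcoefB fcoefD !fcoefXn !fcoef1 /=.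
by rewrite subr0 addr0 !mulr1.
Qed.

End RamanujanSeries.

(** * Coefficients of the generating function *)

Section GeneratingFunction.
Variable K : comNzRingType.

Lemma fcoef_sum_monomials (c : nat -> K) n :
  fcoef (fps_sum (fun k => c k *: fpsX ^+ k)) n = c n.
Proof.
rewrite /fps_sum /= fcoef_sum big_ord_recr big1 /= ?add0r => [|i _].
  by rewrite fcoefXn eqxx mulr1.
by rewrite /= fcoefXn gtn_eqF ?mulr0.
Qed.

Lemma fcoef_comp_scaleX (f : fps K) (a : K) n :
  fcoef (fps_comp f (a *: fpsX)) n = fcoef f n * a ^+ n.
Proof.
rewrite -(fcoef_sum_monomials (fun n => fcoef f n * a ^+ n)) /fps_comp /=.
congr (fcoef _ n); apply: eq_bigr => k _.
by rewrite exprZn scalerA.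
Qed.

Lemma sum_even_index (n : nat) (f : nat -> K) :
  \sum_(j < n.+1) (if odd j then 0 else f j) = \sum_(k < (n./2).+1) f (2 * k)%N.
Proof.
elim: n => [|n IHn]; first by rewrite !big_ord1.
rewrite big_ord_recr /= IHn uphalf_half; case odd_n: (odd n) => /=.
  rewrite add1n [RHS]big_ord_recr /=; congr (_ + f _).
  by have := odd_double_half n; rewrite odd_n; lia.
by rewrite addr0 add0n.
Qed.

End GeneratingFunction.

(** By Pascal's rule the sum runs over the whole row [n] of the triangle. *)
Lemma sum_bin_odd n : (\sum_(k < (n./2).+1) 'C(n.+1, (2 * k).+1) = 2 ^ n)%N.
Proof.
have pairs m (f : nat -> nat) :
    (\sum_(k < m) (f (2 * k) + f (2 * k).+1) = \sum_(j < 2 * m) f j)%N.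
  elim: m => [|m IHm]; first by rewrite muln0 !big_ord0.
  by rewrite big_ord_recr /= IHm mulnS !big_ord_recr /= addnA.
under eq_bigr => k _ do rewrite binS addnC.
rewrite (pairs _ (fun j => 'C(n, j))).
have -> : (\sum_(j < 2 * (n./2).+1) 'C(n, j) = \sum_(j < n.+1) 'C(n, j))%N.
  have := odd_double_half n; case: (odd n) => nE.
    by rewrite (_ : 2 * (n./2).+1 = n.+1)%N //; lia.
  rewrite (_ : 2 * (n./2).+1 = n.+2)%N; last by lia.
  by rewrite big_ord_recr /= bin_small ?addn0.
rewrite -[2%N]/(1 + 1)%N expnDn; apply: eq_bigr => j _.
by rewrite !exp1n !muln1.
Qed.

Section Y.
Variable R : realType.
Local Notation C := R[i].

Lemma natr_neq0 m : (0 < m)%N -> m%:R != 0 :> C.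
Proof. by rewrite Num.Theory.pnatr_eq0 -lt0n. Qed.

Lemma natfpsV m : (0 < m)%N -> (m%:R : fps C)^-1 = (m%:R^-1)%:A.
Proof.
move=> m_gt0; have mV : m%:R * (m%:R^-1)%:A = 1 :> fps C.
  by rewrite mulr_natl -[_ *+ m]scaler_nat scalerA divff ?scale1r ?natr_neq0.
have unit_m : (m%:R : fps C) \is a GRing.unit.
  by apply/unitrPr; exists (m%:R^-1)%:A.
by apply: (mulrI unit_m); rewrite divrr.
Qed.

Lemma fcoef_Omega m :
  fcoef (Omega R) m = if odd m then 0 else (m.+1`!%:R^-1 : C) *: U R m./2.
Proof.
rewrite /Omega /= fcoef_sum.
have monomial k : fcoef (((2 * k + 1)`!%:R^-1 * U R k) *: fpsX ^+ (2 * k)) m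
    = if m == (2 * k)%N then ((2 * k + 1)`!%:R^-1 * U R k) else 0.
  by rewrite /= fcoefXn; case: eqP; rewrite ?mulr1 ?mulr0.
under eq_bigr do rewrite monomial.
case odd_m: (odd m).
  by apply: big1 => k _; case: eqP => // mE; rewrite mE mul2n odd_double in odd_m.
have mE : m = (2 * m./2)%N by rewrite mul2n -[LHS]odd_double_half odd_m.
have lt_m : (m./2 < m.+1)%N by lia.
rewrite (bigD1 (Ordinal lt_m)) //= -mE eqxx big1 ?addr0 => [|k].
  by rewrite addn1 natfpsV ?fact_gt0 // mulr_algl.
rewrite -val_eqE /= => ne_k; case: eqP => // mk; case/eqP: ne_k; lia.
Qed.

Lemma fcoef_exp_theta m :
  fcoef (fps_exp ((theta R ^+ 2 / 2%:R) *: fpsX)) m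
    = (m`!%:R^-1 * 2%:R^-1 ^+ m : C) *: theta R ^+ (2 * m).
Proof.
rewrite /fps_exp fcoef_comp_scaleX [fcoef (Fps _) m]/=.
rewrite natfpsV ?fact_gt0 // natfpsV // mulr_algl mulr_algr.
by rewrite exprZn scalerA exprM.
Qed.

Lemma fcoef_Omega_half m :
  fcoef (fps_comp (Omega R) (2%:R^-1 *: fpsX)) m
    = if odd m then 0
      else (m.+1`!%:R^-1 * 2%:R^-1 ^+ m : C) *: U R m./2.
Proof.
rewrite fcoef_comp_scaleX fcoef_Omega; case: (odd m); first by rewrite mul0r.
by rewrite natfpsV // exprZn expr1n mulr_algr scalerA [in RHS]mulrC.
Qed.

(** The product formula for the coefficients, with the two factors left
    abstract so that only their coefficients enter the computation. The numerical
    identity behind it is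
    [n! / ((n-2k)! (2k+1)!) = 'C(n+1, 2k+1) / (n+1)]. *)
Lemma egf_mul_coef (Y : nat -> fps C) (E F : fps (fps C)) n :
    egf Y = E * F ->
    (forall m, fcoef E m
       = (m`!%:R^-1 * 2%:R^-1 ^+ m : C) *: theta R ^+ (2 * m)) ->
    (forall m, fcoef F m
       = if odd m then 0
         else (m.+1`!%:R^-1 * 2%:R^-1 ^+ m : C) *: U R m./2) ->
  Y n = (2%:R ^+ n * n.+1%:R)^-1 *:
        \sum_(k < (n./2).+1)
          'C(n.+1, (2 * k).+1)%:R *: (theta R ^+ (2 * n - 4 * k) * U R k).
Proof.
move=> + coefE coefF.
move=> /(congr1 (fun f => fcoef f n)); rewrite [LHS]fcoef_sum_monomials.
rewrite natfpsV ?fact_gt0 // mulr_algl fcoefM => Yn.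
have nz k : (0 < k)%N -> k%:R != 0 :> C := @natr_neq0 k.
have -> : Y n = n`!%:R *: (n`!%:R^-1 *: Y n).
  by rewrite scalerA divff ?scale1r // nz ?fact_gt0.
rewrite {}Yn (reindex_inj rev_ord_inj) /=.
pose G j := ((n - j)`!%:R^-1 * 2%:R^-1 ^+ (n - j) * (j.+1`!%:R^-1 * 2%:R^-1 ^+ j) : C)
  *: (theta R ^+ (2 * (n - j)) * U R j./2).
have term (j : 'I_n.+1) : fcoef E (n.+1 - j.+1) * fcoef F (n - (n.+1 - j.+1))
    = if odd j then 0 else G j.
  have le_jn : (j <= n)%N by rewrite -ltnS.
  rewrite subSS (subKn le_jn) coefE coefF.
  case: (odd j); first by rewrite mulr0.
  by rewrite -scalerAl -scalerAr scalerA /G.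
under eq_bigr do rewrite term.
rewrite sum_even_index scaler_sumr [RHS]scaler_sumr; apply: eq_bigr => k _.
rewrite /G !scalerA.
have le_kn : (2 * k <= n)%N by have := ltn_ord k; lia.
have -> : (2 * (n - 2 * k) = 2 * n - 4 * k)%N by lia.
have -> : (2 * k)./2 = k by rewrite mul2n doubleK.
congr (_ *: _).
have binE : 'C(n.+1, (2 * k).+1)%:R * ((2 * k).+1`!%:R * (n - 2 * k)`!%:R)
    = n.+1%:R * n`!%:R :> C.
  by rewrite -!natrM -factS -(bin_fact (m := (2 * k).+1) (n := n.+1)) ?subSS.
have f1 := nz _ (fact_gt0 (2 * k).+1); have f2 := nz _ (fact_gt0 (n - 2 * k)).
have -> : 'C(n.+1, (2 * k).+1)%:R
    = n.+1%:R * n`!%:R / ((2 * k).+1`!%:R * (n - 2 * k)`!%:R) :> C.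
  by rewrite -binE mulfK // mulf_neq0.
have -> : 2%:R ^+ n = 2%:R ^+ (n - 2 * k) * 2%:R ^+ (2 * k) :> C.
  by rewrite -exprD subnK.
have p1 : 2%:R ^+ (n - 2 * k) != 0 :> C by rewrite expf_neq0 ?nz.
have p2 : 2%:R ^+ (2 * k) != 0 :> C by rewrite expf_neq0 ?nz.
rewrite !exprVn; move: (n.+1%:R : C) (nz n.+1 isT) => N nS; field.
by rewrite f1 f2 p1 p2 nS.
Qed.

Lemma Y_formula (Y : nat -> fps C) n :
    egf Y = fps_exp ((theta R ^+ 2 / 2%:R) *: fpsX)
            * fps_comp (Omega R) (2%:R^-1 *: fpsX) ->
  Y n = (2%:R ^+ n * n.+1%:R)^-1 *:
        \sum_(k < (n./2).+1)
          'C(n.+1, (2 * k).+1)%:R *: (theta R ^+ (2 * n - 4 * k) * U R k).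
Proof.
by move=> hY; apply: egf_mul_coef hY fcoef_exp_theta fcoef_Omega_half.
Qed.

Lemma homogeneous2_term n k : (k < (n./2).+1)%N ->
  homogeneous2 (2 * n) (theta R ^+ (2 * n - 4 * k) * U R k).
Proof.
move=> lt_k; rewrite -{1}(_ : 2 * n - 4 * k + 4 * k = 2 * n)%N; last by lia.
apply: homogeneous2M; first exact: homogeneous2_thetaX.
exact/homogeneous2_SL2/quasimodular_SL2_U.
Qed.

Lemma fcoef_thetaX0 m : fcoef (theta R ^+ m) 0 = 1.
Proof.
elim: m => [|m IHm]; first by rewrite expr0 fcoef1.
by rewrite exprS fcoefM0 fcoef_theta0 IHm mulr1.
Qed.

Lemma fcoef_combination0 n :
  fcoef ((2%:R ^+ n * n.+1%:R)^-1 *: \sum_(k < (n./2).+1)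
    'C(n.+1, (2 * k).+1)%:R *: (theta R ^+ (2 * n - 4 * k) * U R k)) 0
  = n.+1%:R^-1.
Proof.
have fcoefZ (c : C) (f : fps C) : fcoef (c *: f) 0 = c * fcoef f 0 by [].
rewrite fcoefZ fcoef_sum.
under eq_bigr do rewrite fcoefZ fcoefM0 fcoef_thetaX0 fcoef_U0 !mulr1.
rewrite -natr_sum sum_bin_odd natrX invfM mulrAC mulVf ?mul1r //.
by rewrite expf_neq0 // natr_neq0.
Qed.

End Y.

Theorem theorem1p1 (R : realType) (Y : nat -> fps R[i])
    (hY : egf Y = fps_exp ((theta R ^+ 2 / 2%:R) *: fpsX)
                  * fps_comp (Omega R) (2%:R^-1 *: fpsX))
    (n : nat) :
  (eq_mod_deg 1 (Y n) (fps_const (n.+1%:R^-1)) /\ quasimodular n (Y n)) /\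
  Y n = (2%:R ^+ n * n.+1%:R)^-1 *:
        \sum_(k < (n./2).+1)
          'C(n.+1, (2 * k).+1)%:R *: (theta R ^+ (2 * n - 4 * k) * U R k).
Proof.
have YE := Y_formula n hY; split; last exact: YE.
rewrite YE; split; first by case=> [_|//]; apply: fcoef_combination0.
apply: (@homogeneous2Z R (2 * n)); apply: homogeneous2_sum => k.
by apply: homogeneous2Z; apply: homogeneous2_term.
Qed.
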